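(* Let $G$ be a finite non-abelian group, let $H$ be a normal subgroup of $G$ with $H \neq Z(H,G)$, and let $g \in K(H,G)$. If $h \in G$ is such that $g$ and $h$ are conjugate elements of $G$, then the graphs $\Gamma_{H,G}^g$ and $\Gamma_{H,G}^h$ are isomorphic.
   Context: For $x,y$ in a group, $[x,y] = x^{-1}y^{-1}xy$. For a subgroup $H$ of $G$: $Z(H,G) = \{x \in H : xy = yx \text{ for all } y \in G\}$ and $K(H,G) = \{[x,y] : x \in H,\ y \in G\}$. For $g \in G$, the relative $g$-noncommuting graph $\Gamma_{H,G}^g$ is the simple undirected graph with vertex set $G$ in which two distinct vertices $x,y$ are adjacent if and only if ($x \in H$ or $y \in H$) and $[x,y] \neq g$ and $[x,y] \neq g^{-1}$. *)

(* Defs.v *)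
From HB Require Import structures.
From mathcomp Require Import all_boot all_fingroup.

Set Implicit Arguments.
Unset Strict Implicit.
Unset Printing Implicit Defensive.

Local Open Scope group_scope.

Record sgraph := SGraph {
  vertex : finType;
  adj : rel vertex;
  adj_sym : symmetric adj;
  adj_irrefl : irreflexive adj
}.

Definition sgraph_iso (A B : sgraph) : Prop :=
  exists2 f : vertex A -> vertex B,
    bijective f & forall x y, adj (f x) (f y) = adj x y.

Section RelativeNoncommutingGraph.

Variables (gT : finGroupType) (H G : {group gT}) (g : gT).

(* The vertex type is the subtype [subg G] of the elements of G, since G need
   not be the whole of gT. The library commutator [~ x, y] is x^-1 * x ^ y, that
   is, x^-1 * y^-1 * x * y. *)
Definition noncommuting_adj : rel [subg G] := fun x y =>
  [&& x != y,
      (sgval x \in H) || (sgval y \in H),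
      [~ sgval x, sgval y] != g
    & [~ sgval x, sgval y] != g^-1].

Lemma noncommuting_adj_sym : symmetric noncommuting_adj.
Proof.
move=> x y; rewrite /noncommuting_adj eq_sym orbC -(invg_comm (sgval x)).
rewrite (inv_eq invgK) (inj_eq invg_inj).
by congr (_ && (_ && _)); rewrite andbC.
Qed.

Lemma noncommuting_adj_irrefl : irreflexive noncommuting_adj.
Proof. by move=> x; rewrite /noncommuting_adj eqxx. Qed.

Definition relative_noncommuting_graph : sgraph :=
  SGraph noncommuting_adj_sym noncommuting_adj_irrefl.

End RelativeNoncommutingGraph.

(* Main.v *)
Require Import Defs.
From HB Require Import structures.
From mathcomp Require Import all_boot all_fingroup.

Local Open Scope group_scope.

(** Conjugation by an element t of G is an automorphism of G, so it permutes the
    vertices, sends [x, y] to [x, y] ^ t and, H being normal, preserves H. It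
    therefore turns adjacency for g into adjacency for g ^ t, and every
    conjugate of g in G has the form g ^ t. *)

Lemma noncommuting_adjJ (gT : finGroupType) (H G : {group gT}) (g : gT)
    (t x y : [subg G]) (nHG : G \subset 'N(H)) :
  noncommuting_adj H (g ^ sgval t) (x ^ t) (y ^ t) = noncommuting_adj H g x y.
Proof.
have nHt : sgval t \in 'N(H) by apply: (subsetP nHG); apply: subgP.
have valJ (z : [subg G]) : sgval (z ^ t) = sgval z ^ sgval t.
  by rewrite morphJ ?inE.
by rewrite /noncommuting_adj !valJ !memJ_norm // -conjRg -conjVg
  !(inj_eq (conjg_inj _)).
Qed.

Theorem theorem2p11 (gT : finGroupType) (G H : {group gT}) (g h : gT)
    (nabG : ~~ abelian G) (nHG : H <| G)
    (neqHZ : H :!=: 'C_H(G))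
    (gK : g \in commg_set H G)
    (hG : h \in G) (conj_gh : h \in g ^: G) :
  sgraph_iso (relative_noncommuting_graph H G g)
             (relative_noncommuting_graph H G h).
Proof.
case/imsetP: conj_gh => t tG ->.
exists (fun x : [subg G] => x ^ subg G t) => [|x y /=].
  by exists (fun x : [subg G] => x ^ (subg G t)^-1); [exact: conjgK | exact: conjgKV].
by rewrite -{1}(subgK _ tG) noncommuting_adjJ ?normal_norm.
Qed.
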